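(* Let $(X,\succcurlyeq)$ be a Banach lattice, where $\succcurlyeq$ is induced by an orthogonal and subdual nonempty closed convex cone $K\subseteq X$. Then, for any $x\in X$, we have $x^+\in P_K(x)$. Let $f:K\to X$ be a mapping, and suppose that the following conditions are satisfied: a) $(X,\succcurlyeq)$ is re-chain-complete; b) $f$ is $\succcurlyeq$-increasing; c) there is $y_*\in K$ such that $f(y_* )\preccurlyeq y_*$. Then $f$ has a best approximation point on $K$.
   Context: Banach spaces are real. The order induced by $K$ is $x\succcurlyeq y$ (equivalently $y\preccurlyeq x$) iff $x-y\in K$. $(X,\succcurlyeq)$ is a Banach lattice if $\succcurlyeq$ is a lattice ordering on $X$ (for all $x,y\in X$, $x\vee y$ and $x\wedge y$ exist) and $0\preccurlyeq x\preccurlyeq y$ implies $\|x\|\le\|y\|$. $x^+=x\vee 0$. The duality mapping $J:X\to 2^{X^*}$ is $J(x)=\{j\in X^*:\langle x,j\rangle=\|x\|^2=\|j\|^2\}$; $\langle jx,y\rangle$ denotes the value of the functional $jx\in J(x)$ at $y$. The metric projection is $P_K(x)=\{x'\in K:\|x-x'\|=\inf_{z\in K}\|x-z\|\}$. $K$ is orthogonal if for all $x,y\in X$, $x\wedge y=0$ implies $\langle jx,y\rangle=0$ for every $jx\in J(x)$. $K$ is subdual if for every $x\in K$ and every $jx\in J(x)$, $\langle jx,z\rangle\ge 0$ for every $z\in K$. A chain is a nonempty totally ordered subset; $(X,\succcurlyeq)$ is re-chain-complete if every chain in $X$ that has a lower bound has a greatest lower bound in $X$. $f$ is $\succcurlyeq$-increasing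 if $x\preccurlyeq y$ in $K$ implies $f(x)\preccurlyeq f(y)$. A point $x_0\in K$ is a best approximation point for $f$ on $K$ if $x_0\in P_K(f(x_0))$, i.e. $\|f(x_0)-x_0\|=\inf_{z\in K}\|f(x_0)-z\|$. *)

(* Defs.v *)
From HB Require Import structures.
From mathcomp Require Import all_boot all_order all_algebra.
From mathcomp Require Import all_classical all_reals all_analysis.

Set Implicit Arguments.
Unset Strict Implicit.
Unset Printing Implicit Defensive.

Import Order.TTheory GRing.Theory Num.Theory.
Import numFieldNormedType.Exports.

Local Open Scope classical_set_scope.
Local Open Scope ring_scope.

Section ConeOrder.
Context (R : realType) (X : normedModType R).
Implicit Types (K A : set X) (x y z : X).

Definition closed_convex_cone K :=
  [/\ closed K, convex_set (K : set (convex_lmodType X)) &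
      forall (t : R) x, 0 <= t -> K x -> K (t *: x)].

Definition cone_le K x y : Prop := K (y - x).

Definition is_cone_glb K A x :=
  (forall a, A a -> cone_le K x a) /\
  forall z, (forall a, A a -> cone_le K z a) -> cone_le K z x.

Definition is_cone_lub K A x :=
  (forall a, A a -> cone_le K a x) /\
  forall z, (forall a, A a -> cone_le K a z) -> cone_le K x z.

Definition cone_partial_order K :=
  [/\ forall x, cone_le K x x,
      forall x y, cone_le K x y -> cone_le K y x -> x = y &
      forall x y z, cone_le K x y -> cone_le K y z -> cone_le K x z].

Definition cone_lattice_order K :=
  [/\ cone_partial_order K,
      forall x y, exists z, is_cone_lub K [set x; y] z &
      forall x y, exists z, is_cone_glb K [set x; y] z].

(* The completeness of the norm is carried by the type of the space in which
   this predicate is used. *)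
Definition banach_lattice K :=
  cone_lattice_order K /\
  forall x y, cone_le K 0 x -> cone_le K x y -> `|x| <= `|y|.

(* The default value 0 is only returned when [x] and [y] have no least upper
   bound, which does not happen when [cone_lattice_order K] holds. *)
Definition cone_join K x y : X := xget 0 (is_cone_lub K [set x; y]).

Definition pos_part K x : X := cone_join K x 0.

(* The supremum is over a nonempty bounded set of reals when [j] is continuous,
   hence is the usual norm of the topological dual. *)
Definition dual_norm (j : {linear X -> R^o}) : R :=
  sup [set `|j z : R| | z in [set z : X | `|z| <= 1]].

Definition duality_map x : set {linear X -> R^o} :=
  [set j : {linear X -> R^o} |
    [/\ continuous j, j x = `|x| ^+ 2 & `|x| ^+ 2 = dual_norm j ^+ 2]].

Definition metric_projection K x : set X :=
  [set x' | K x' /\ `|x - x'| = inf [set `|x - z| | z in K]].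

Definition orthogonal_cone K :=
  forall x y, is_cone_glb K [set x; y] 0 ->
  forall j : {linear X -> R^o}, duality_map x j -> j y = 0.

Definition subdual_cone K :=
  forall x, K x -> forall j : {linear X -> R^o}, duality_map x j ->
  forall z, K z -> 0 <= (j z : R).

Definition cone_chain K A := A !=set0 /\ total_on A (cone_le K).

Definition re_chain_complete K :=
  forall A, cone_chain K A ->
  (exists l, forall a, A a -> cone_le K l a) -> exists m, is_cone_glb K A m.

Definition cone_increasing K (f : K -> X) :=
  forall x y : K, cone_le K (val x) (val y) -> cone_le K (f x) (f y).

Definition best_approximation_point K (f : K -> X) (x0 : K) :=
  metric_projection K (f x0) (val x0).

End ConeOrder.

(* Main.v *)
Require Import Defs.
From mathcomp Require Import all_boot all_order all_algebra.
From mathcomp Require Import all_classical all_reals all_analysis.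
From mathcomp Require Import lra.
From HB Require Import structures.
Import Order.TTheory GRing.Theory Num.Theory.
Import numFieldNormedType.Exports.
Local Open Scope classical_set_scope.
Local Open Scope ring_scope.

(** The positive part of [x] is a nearest point of [K] to [x].  Write
    [u] for the negative part [pos_part K x - x].  It is disjoint from
    [pos_part K x], so orthogonality makes every [j] in the duality map of [u]
    vanish on [pos_part K x]; hence [j (- x) = j u = `|u| ^+ 2].  For [z] in
    [K], subduality gives [0 <= j z], so
    [`|u| ^+ 2 <= j (z - x) <= `|u| * `|z - x|], that is
    [`|x - pos_part K x| <= `|x - z|].

    Orthogonality and subduality only speak about elements of the duality map,
    so the argument rests on that map having nonempty values, which is the
    Hahn-Banach theorem.  It is obtained here in the form: every sublinear
    functional dominates a linear one.  A minimal sublinear functional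
    below the given one exists by Zorn's lemma, and it is linear because tilting
    it in a direction [x] (see [tilt]) produces a smaller sublinear functional,
    which by minimality is the same one.  A functional attaining the norm at
    [x] is found by tilting the norm in the direction [x] first.

    For the best approximation point, [g x := pos_part K (f x)] is an increasing
    self-map of [K] and, by the first part, its fixed points are best
    approximation points of [f].  The set of the [x] in [K] with
    [g x <= x] contains [ystar] and is closed under infima of chains, which
    exist by re-chain-completeness because 0 bounds [K] from below.  A minimal
    element [m], given by Zorn's lemma, is fixed by [g], since [g m] is again in
    the set and below [m]. *)

(** * Minimal elements *)

Lemma exists_minimal (T : Type) (P : set T) (le : T -> T -> Prop) :
  (forall x, le x x) -> (forall y x z, le x y -> le y z -> le x z) ->
  (forall x y, le x y -> le y x -> x = y) ->
  P !=set0 ->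
  (forall A, A `<=` P -> A !=set0 -> total_on A le ->
     exists2 m, P m & forall a, A a -> le m a) ->
  exists2 m, P m & forall p, P p -> le p m -> p = m.
Proof.
move=> lexx le_trans le_anti [p0 Pp0] chainP.
pose r (x y : {x | P x}) := `[< le (sval y) (sval x) >].
have [|||| [m Pm] minm] := @Zorn {x | P x} r.
- by move=> x; exact/asboolP.
- by move=> x y z /asboolP yx /asboolP zy; apply/asboolP; exact: le_trans yx.
- move=> [x Px] [y Py] /asboolP yx /asboolP xy; apply: eq_exist.
  exact: le_anti.
- move=> A totA; have [->|/set0P[a Aa]] := eqVneq A set0.
    by exists (exist _ p0 Pp0).
  have [|||m Pm mA] := chainP (sval @` A).
  + by move=> _ [[x Px] _ <-].
  + by exists (sval a); exists a.
  + by move=> _ _ [x Ax <-] [y Ay <-]; case: (totA x y Ax Ay) => /asboolP;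
      [right|left].
  + exists (exist _ m Pm) => s As; apply/asboolP; apply: mA; by exists s.
- exists m => // p Pp pm.
  by have /(congr1 sval) := minm (exist _ p Pp) (asboolT pm).
Qed.

(** * Sublinear functionals and the Hahn-Banach theorem *)

(** Homogeneity is stated as an inequality because that is the half that
    constructions by infima give directly; equality follows, from the inequality
    for the inverse factor, and from [p (0 + 0) <= p 0 + p 0] when the factor
    is 0. *)
Definition sublinear {R : realType} {X : lmodType R} (p : X -> R) :=
  (forall x y, p (x + y) <= p x + p y) /\
  (forall (t : R) x, 0 <= t -> p (t *: x) <= t * p x).

(** When [p] is sublinear, [tilt p x] is the largest sublinear [q] below [p]
    with [q (- x) <= - p x]: such a [q] satisfies
    [q z <= q (z + t *: x) + t * q (- x) <= p (z + t *: x) - t * p x].  Thus a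
    linear functional below [tilt p x] is one below [p] that touches [p] at
    [x]. *)
Definition tilt {R : realType} {X : lmodType R} (p : X -> R) (x z : X) : R :=
  inf [set p (z + t *: x) - t * p x | t in [set t : R | 0 <= t]].

Section Sublinear.
Context {R : realType} {X : lmodType R}.
Implicit Types (p q : X -> R) (x z w : X).

Lemma sublinear0 {p} : sublinear p -> p 0 = 0.
Proof.
move=> [pD pZ]; apply/eqP; rewrite eq_le.
have := pD 0 0; have := pZ 0 0 (lexx _); rewrite scale0r addr0 mul0r.
by move=> -> /=; lra.
Qed.

Lemma sublinearN_ge {p} x : sublinear p -> - p (- x) <= p x.
Proof.
by move=> sp; have := sp.1 x (- x); rewrite subrr sublinear0//; lra.
Qed.

(** The defining set is bounded below by [- p (- z)], since
    [t * p x = p (t *: x) <= p (z + t *: x) + p (- z)]; without such a bound the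
    infimum of reals would be a meaningless default. *)
Lemma tilt_le {p} x z {t} : sublinear p -> 0 <= t ->
  tilt p x z <= p (z + t *: x) - t * p x.
Proof.
move=> [pD pZ] t0; apply: ge_inf; last by exists t.
exists (- p (- z)) => _ [s /= s0 <-].
have := pD (z + s *: x) (- z); rewrite addrAC subrr add0r => h.
suff: s * p x <= p (s *: x) by lra.
move: s0; rewrite le_eqVlt => /predU1P[<-|s0].
  by rewrite mul0r scale0r (sublinear0 (conj pD pZ)).
have := pZ s^-1 (s *: x); rewrite scalerA mulVf ?gt_eqF// scale1r.
by rewrite ler_pdivlMl// invr_ge0 => ->//; exact: ltW.
Qed.

Lemma le_tilt {p x z c} :
  (forall t, 0 <= t -> c <= p (z + t *: x) - t * p x) -> c <= tilt p x z.
Proof.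
move=> h; apply: lb_le_inf; last by move=> _ [t t0 <-]; exact: h.
by exists (p (z + 0 *: x) - 0 * p x); exists 0 => //=.
Qed.

Lemma tilt_le_id {p} x z : sublinear p -> tilt p x z <= p z.
Proof.
by move=> /(tilt_le x z)/(_ (lexx 0)); rewrite scale0r addr0 mul0r subr0.
Qed.

Lemma le_mul_tilt {p x z s c} : 0 <= s ->
  (forall t, 0 <= t -> c <= s * (p (z + t *: x) - t * p x)) ->
  c <= s * tilt p x z.
Proof.
rewrite le_eqVlt => /predU1P[<- /(_ 0)|s0 h]; first by rewrite !mul0r; exact.
rewrite -ler_pdivrMl//; apply: le_tilt => t t0.
by rewrite ler_pdivrMl//; exact: h.
Qed.

(** Parameters [t] for [z] and [s] for [w] give the parameter [t + s] for
    [z + w], and [t] for [z] gives [s * t] for [s *: z]. *)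
Lemma sublinear_tilt {p} x : sublinear p -> sublinear (tilt p x).
Proof.
move=> sp; have [pD pZ] := sp; split=> [z w|s z s0].
  rewrite -lerBlDr; apply: le_tilt => t t0; rewrite lerBlDr -lerBlDl.
  apply: le_tilt => s s0; rewrite lerBlDl.
  apply: le_trans (tilt_le x (z + w) sp (addr_ge0 t0 s0)) _.
  by have := pD (z + t *: x) (w + s *: x); rewrite addrACA -scalerDl; lra.
apply: le_mul_tilt => // t t0.
apply: le_trans (tilt_le x (s *: z) sp (mulr_ge0 s0 t0)) _.
by have := pZ s (z + t *: x) s0; rewrite scalerDr scalerA; lra.
Qed.

(** The pointwise infimum works.  It is finite: given [a] in the chain, any
    other member [q] is above [a] or below it, and both imply
    [- a (- z) <= q z]. *)
Lemma sublinear_chain_lb {A : set (X -> R)} :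
  A `<=` sublinear -> A !=set0 ->
  total_on A (fun p q => forall z, p z <= q z) ->
  exists2 m, sublinear m & forall p, A p -> forall z, m z <= p z.
Proof.
move=> Asub [a Aa] totA; pose m z := inf [set p z | p in A].
have m_le p z : A p -> m z <= p z.
  move=> Ap; apply: ge_inf; last by exists p.
  exists (- a (- z)) => _ [q Aq <-].
  have := sublinearN_ge z (Asub _ Aq); have := sublinearN_ge z (Asub _ Aa).
  by case: (totA a q Aa Aq) => [/(_ z)|/(_ (- z))]; lra.
have le_m c z : (forall p, A p -> c <= p z) -> c <= m z.
  move=> h; apply: lb_le_inf; last by move=> _ [p Ap <-]; exact: h.
  by exists (a z); exists a.
exists m; last by move=> p Ap z; exact: m_le.
split=> [z w|t z].
  rewrite -lerBlDr; apply: (le_m) => p Ap; rewrite lerBlDr -lerBlDl.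
  apply: le_m => q Aq; rewrite lerBlDl.
  (* The smaller of [p] and [q] bounds the infimum at [z + w]. *)
  have [pq|qp] := totA p q Ap Aq.
    apply: le_trans (m_le p (z + w) Ap) _.
    by apply: le_trans ((Asub _ Ap).1 z w) _; rewrite lerD2l.
  apply: le_trans (m_le q (z + w) Aq) _.
  by apply: le_trans ((Asub _ Aq).1 z w) _; rewrite lerD2r.
rewrite le_eqVlt => /predU1P[<-|t0].
  by rewrite scale0r mul0r -(sublinear0 (Asub _ Aa)); exact: m_le.
rewrite -ler_pdivrMl//; apply: le_m => p Ap; rewrite ler_pdivrMl//.
by apply: le_trans (m_le p _ Ap) _; exact: (Asub _ Ap).2 (ltW t0).
Qed.

(** A minimal sublinear functional equals each of its tilts, so that
    [p z <= p (z + x) - p x] by taking parameter 1 in the tilt: this is the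
    superadditivity that is missing for linearity. *)
Lemma minimal_sublinear_linear {p} : sublinear p ->
  (forall q, sublinear q -> (forall z, q z <= p z) -> q = p) ->
  forall t x y, p (t *: x + y) = t * p x + p y.
Proof.
move=> sp minp; have [pD pZ] := sp.
have addp x y : p (x + y) = p x + p y.
  apply/eqP; rewrite eq_le pD /=.
  have tiltE : tilt p x = p.
    by apply: minp => [|z]; [exact: sublinear_tilt | exact: tilt_le_id].
  have := tilt_le x y sp ler01; rewrite tiltE scale1r mul1r [y + x]addrC; lra.
have oppp x : p (- x) = - p x.
  by apply/eqP; rewrite -addr_eq0 -addp addNr sublinear0.
have scalep t x : 0 <= t -> p (t *: x) = t * p x.
  move=> t0; apply/eqP; rewrite eq_le pZ//=.
  by have := pZ t (- x) t0; rewrite scalerN !oppp; lra.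
move=> t x y; rewrite addp; congr (_ + _).
have [t0|t0] := leP 0 t; first exact: scalep.
by rewrite -[t]opprK scaleNr oppp scalep ?mulNr// oppr_ge0 ltW.
Qed.

Lemma hahn_banach_sublinear {p} : sublinear p ->
  exists j : {linear X -> R^o}, forall z, j z <= p z.
Proof.
move=> sp; pose P := [set q : X -> R | sublinear q /\ forall z, q z <= p z].
have [|||||m [sm mp] minm] :=
    @exists_minimal _ P (fun q r : X -> R => forall z, q z <= r z).
- by [].
- by move=> q r s rq qs z; exact: le_trans (qs z).
- by move=> q r qr rq; apply/funext => z; apply/eqP; rewrite eq_le qr rq.
- by exists p.
- move=> A AP [a Aa] totA.
  have [|||m sm mA] := @sublinear_chain_lb A; first by move=> q /AP[].
  + by exists a.
  + by [].
  + exists m => //; split=> // z.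
    by apply: le_trans (mA a Aa z) _; exact: (AP _ Aa).2.
- have linm : linear (m : X -> R^o).
    move=> t x y; apply: minimal_sublinear_linear => // q sq qm.
    by apply: minm => //; split=> // z; exact: le_trans (mp z).
  pose H := GRing.isLinear.Build R X R^o *:%R m linm.
  by exists (HB.pack_for {linear X -> R^o} m H).
Qed.

End Sublinear.

(** * The duality mapping *)

Section Duality.
Context {R : realType} {X : normedModType R}.
Implicit Types (x z : X).

Lemma sublinear_norm : sublinear (fun x : X => `|x|).
Proof.
by split=> [|t x t0]; [exact: ler_normD | rewrite normrZ ger0_norm].
Qed.

(** A linear functional below the tilt of the norm at [x] is below the norm, and
    parameter 1 in the tilt bounds it by [- `|x|] at [- x]. *)
Lemma norming_functional x :
  exists j : {linear X -> R^o}, j x = `|x| /\ forall z, `|j z : R| <= `|z|.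
Proof.
have sn := sublinear_norm.
have [j jtilt] := hahn_banach_sublinear (sublinear_tilt x sn).
have j_le z : j z <= `|z| by apply: le_trans (jtilt z) _; exact: tilt_le_id.
exists j; split.
  apply/eqP; rewrite eq_le j_le /=.
  have := le_trans (jtilt (- x)) (tilt_le x (- x) sn ler01).
  by rewrite scale1r addNr normr0 mul1r sub0r linearN lerN2.
by move=> z; rewrite ler_norml j_le andbT lerNl -linearN -normrN j_le.
Qed.

Lemma duality_map_nonempty x :
  exists2 j : {linear X -> R^o}, duality_map x j &
    forall z, j z <= `|x| * `|z|.
Proof.
have [p [px p_le]] := norming_functional x.
have linj : linear (fun z => `|x| * p z : R^o).
  by move=> t y z; rewrite linearP /= mulrDr /GRing.scale /= mulrCA.
pose H := GRing.isLinear.Build R X R^o *:%R _ linj.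
pose j : {linear X -> R^o} :=
  HB.pack_for {linear X -> R^o} (fun z => `|x| * p z) H.
have jE z : j z = `|x| * p z by [].
have j_norm z : `|j z : R| <= `|x| * `|z|.
  by rewrite jE normrM normr_id ler_wpM2l.
exists j; last by move=> z; apply: le_trans (j_norm z); exact: ler_norm.
have ub : ubound [set `|j z : R| | z in [set z | `|z| <= 1]] `|x|.
  by move=> _ [z /= z1 <-]; apply: le_trans (j_norm z) _; rewrite ler_piMr.
split.
- apply: bounded_linear_continuous; apply/linear_boundedP.
  exists `|x|; split; first exact: num_real.
  by move=> r xr z; apply: le_trans (j_norm z) _; rewrite ler_wpM2r// ltW.
- by rewrite jE px expr2.
- congr (_ ^+ 2); apply/eqP; rewrite eq_le; apply/andP; split; last first.
    apply: ge_sup ub; exists `|j 0|; exists 0 => //=; by rewrite normr0 ler01.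
  have [->|x0] := eqVneq x 0.
    rewrite normr0; apply: le_trans (normr_ge0 (j 0)) _.
    apply: ub_le_sup; first by exists `|x|.
    by exists 0 => //=; rewrite normr0 ler01.
  apply: ub_le_sup; first by exists `|x|.
  have nx0 : `|x| != 0 by rewrite normr_eq0.
  exists (`|x|^-1 *: x); first by rewrite /= normrZ normfV normr_id mulVf.
  by rewrite jE linearZ /= px /GRing.scale /= mulVf// mulr1 normr_id.
Qed.

End Duality.

(** * The positive part as a nearest point *)

Section PositivePart.
Context {R : realType} {X : normedModType R} {K : set X}.
Context (K_lattice : cone_lattice_order K).
Implicit Types x y z : X.

Lemma cone_le0 x : cone_le K 0 x = K x.
Proof. by rewrite /cone_le subr0. Qed.

Lemma pos_part_lub x : is_cone_lub K [set x; 0] (pos_part K x).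
Proof.
by have [_ lub _] := K_lattice; have [z lubz] := lub x 0; exact: xgetI lubz.
Qed.

Lemma le_pos_part x : cone_le K x (pos_part K x).
Proof. by apply: (pos_part_lub x).1; left. Qed.

Lemma pos_part_in x : K (pos_part K x).
Proof. by rewrite -cone_le0; apply: (pos_part_lub x).1; right. Qed.

Lemma pos_part_le x y : cone_le K x y -> K y -> cone_le K (pos_part K x) y.
Proof.
by move=> xy Ky; apply: (pos_part_lub x).2 => a [->//|->]; rewrite cone_le0.
Qed.

Lemma pos_part_mono x y :
  cone_le K x y -> cone_le K (pos_part K x) (pos_part K y).
Proof.
move=> xy; have [[_ _ le_trans] _ _] := K_lattice.
apply: pos_part_le; last exact: pos_part_in.
exact: le_trans xy (le_pos_part y).
Qed.

(** If [z] is below both parts, then [pos_part K x - z] is an upper bound of [x]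
    and 0, so it is above [pos_part K x]. *)
Lemma pos_neg_part_disjoint x :
  is_cone_glb K [set pos_part K x - x; pos_part K x] 0.
Proof.
split=> [a [->|->]|z zlb].
- by rewrite cone_le0; exact: le_pos_part.
- by rewrite cone_le0; exact: pos_part_in.
- have zn : K (pos_part K x - x - z) by apply: zlb; left.
  have zp : K (pos_part K x - z) by apply: zlb; right.
  rewrite /cone_le sub0r.
  have -> : - z = pos_part K x - z - pos_part K x by rewrite addrAC subrr sub0r.
  by apply: pos_part_le => //; rewrite /cone_le addrAC.
Qed.

Lemma pos_part_nearest x z : orthogonal_cone K -> subdual_cone K -> K z ->
  `|x - pos_part K x| <= `|x - z|.
Proof.
move=> orthK subK Kz; set u := pos_part K x - x.
have [j jJ j_le] := duality_map_nonempty u.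
have jp : j (pos_part K x) = 0 by exact: orthK (pos_neg_part_disjoint x) _ jJ.
have ju : j u = `|u| ^+ 2 by case: jJ.
have jz : 0 <= (j z : R) by exact: subK (le_pos_part x) _ jJ _ Kz.
have : `|u| ^+ 2 <= `|u| * `|z - x|.
  apply: le_trans (j_le (z - x)).
  by move: ju; rewrite /u !linearB /= jp sub0r => <-; rewrite lerDr.
rewrite [`|x - pos_part K x|]distrC [`|x - z|]distrC -/u expr2.
have [->|u0] := eqVneq u 0; first by rewrite normr0.
by rewrite ler_pM2l// normr_gt0.
Qed.

Lemma metric_projection_pos_part x : orthogonal_cone K -> subdual_cone K ->
  metric_projection K x (pos_part K x).
Proof.
move=> orthK subK; have Kp := pos_part_in x.
split=> //; apply/eqP; rewrite eq_le; apply/andP; split.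
  apply: lb_le_inf; first by exists `|x - pos_part K x|; exists (pos_part K x).
  by move=> _ [z Kz <-]; exact: pos_part_nearest.
apply: ge_inf; last by exists (pos_part K x).
by exists 0 => _ [z _ <-].
Qed.

End PositivePart.

(** * Fixed points of increasing self-maps of the cone *)

Lemma cone_increasing_fixpoint {R : realType} {X : normedModType R} {K : set X}
    (g : K -> K) :
  cone_partial_order K -> re_chain_complete K ->
  (forall x y : K, cone_le K (val x) (val y) ->
     cone_le K (val (g x)) (val (g y))) ->
  (exists y : K, cone_le K (val (g y)) (val y)) ->
  exists x : K, g x = x.
Proof.
move=> [lexx le_anti le_trans] rcc g_mono [y gy].
have Kval (x : K) : K (val x) by exact: set_mem (valP x).
pose le (x z : K) := cone_le K (val x) (val z).
have [|||||m gm minm] := @exists_minimal _ [set x : K | le (g x) x] le.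
- by move=> x; exact: lexx.
- by move=> x z w; exact: le_trans.
- by move=> x z xz zx; apply: val_inj; exact: le_anti.
- by exists y.
- move=> A AP [a Aa] totA.
  have [|| m [m_lb m_glb]] := rcc (val @` A).
  + split; first by exists (val a); exists a.
    by move=> _ _ [x Ax <-] [z Az <-]; exact: totA.
  + by exists 0 => _ [x _ <-]; rewrite cone_le0; exact: Kval.
  + have Km : K m.
      rewrite -cone_le0; apply: m_glb => _ [x _ <-].
      by rewrite cone_le0; exact: Kval.
    pose m' : K := exist _ m (mem_set Km).
    have m'_lb x : A x -> le m' x by move=> Ax; apply: m_lb; exists x.
    exists m' => //; apply: m_glb => _ [x Ax <-].
    exact: le_trans (g_mono _ _ (m'_lb x Ax)) (AP _ Ax).
- by exists m; apply: minm => //; exact: g_mono.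
Qed.

Theorem theorem7p1 (R : realType) (X : completeNormedModType R) (K : set X)
    (K_nonempty : K !=set0)
    (K_cone : closed_convex_cone K)
    (X_lattice : banach_lattice K)
    (K_orthogonal : orthogonal_cone K)
    (K_subdual : subdual_cone K) :
  (forall x : X, metric_projection K x (pos_part K x)) /\
  (forall f : K -> X,
     re_chain_complete K ->
     cone_increasing f ->
     (exists ystar : K, cone_le K (f ystar) (val ystar)) ->
     exists x0 : K, best_approximation_point f x0).
Proof.
have [K_lattice _] := X_lattice.
have proj x : metric_projection K x (pos_part K x).
  exact: metric_projection_pos_part.
split=> // f rcc f_mono [ystar fy].
pose g (x : K) : K :=
  exist _ (pos_part K (f x)) (mem_set (pos_part_in K_lattice (f x))).
have [||| x gx] := @cone_increasing_fixpoint _ _ _ g _ rcc.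
- by have [] := K_lattice.
- by move=> x y xy; apply: pos_part_mono => //; exact: f_mono.
- by exists ystar; apply: pos_part_le => //; exact: set_mem (valP ystar).
- by exists x; rewrite /best_approximation_point -{2}gx; exact: proj.
Qed.
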